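(* Let $p$ be an odd prime, let $q$ be a power of $p$, and let $C_k$ denote the $k$th Catalan number. Then \[ \sum_{k=0}^{q-1}C_kx^k\equiv\frac{1-(1-4x)^{(q+1)/2}}{2x}-x^{q-1}\pmod{p} \] as polynomials in the indeterminate $x$.
   Context: For a natural number $k\ge 0$, the $k$th Catalan number is $C_k=\frac{1}{k+1}\binom{2k}{k}=\binom{2k}{k}-\binom{2k}{k+1}$. The congruence modulo $p$ is between polynomials in $\mathbb{Z}[x]$, meaning that corresponding coefficients are congruent modulo $p$ (equivalently, the two polynomials have equal images in $\mathbb{F}_p[x]$); here the quotient $\frac{1-(1-4x)^{(q+1)/2}}{2x}$ is a polynomial with integer coefficients. A power of $p$ means $q=p^s$ with $s\ge 1$. *)

(* Defs.v *)
From mathcomp Require Import all_boot all_order all_algebra.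

Set Implicit Arguments.
Unset Strict Implicit.
Unset Printing Implicit Defensive.

Import GRing.Theory.

Local Open Scope ring_scope.

(* The division is exact: see mul_catalan. *)
Definition catalan (k : nat) : nat := ('C(2 * k, k) %/ k.+1)%N.

Lemma bin_succ_catalan (k : nat) :
  (k.+1 * 'C(2 * k, k.+1) = k * 'C(2 * k, k))%N.
Proof. by rewrite mul_bin_left; congr (_ * _)%N; rewrite mul2n -addnn addnK. Qed.

Lemma dvdn_catalan (k : nat) : (k.+1 %| 'C(2 * k, k))%N.
Proof.
rewrite -(@Gauss_dvdr k.+1 k); last exact: coprimeSn.
by rewrite -bin_succ_catalan dvdn_mulr.
Qed.

Lemma mul_catalan (k : nat) : (k.+1 * catalan k = 'C(2 * k, k))%N.
Proof. by rewrite mulnC divnK // dvdn_catalan. Qed.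

Lemma catalanB (k : nat) :
  catalan k = ('C(2 * k, k) - 'C(2 * k, k.+1))%N.
Proof.
apply/eqP; rewrite -(eqn_pmul2l (ltn0Sn k)) mul_catalan mulnBr.
by rewrite bin_succ_catalan -mulnBl subSnn mul1n.
Qed.

Definition congr_polyz (p : nat) (f g : {poly int}) : Prop :=
  forall i : nat, (f`_i = g`_i %[mod p])%Z.

(* Main.v *)
Require Import Defs.
From mathcomp Require Import all_boot all_order all_algebra.
From mathcomp Require Import ring zify.

Set Implicit Arguments.
Unset Strict Implicit.
Unset Printing Implicit Defensive.

Import GRing.Theory Num.Theory.

Local Open Scope ring_scope.

(** Write C for the truncated Catalan series (the sum of C_k x^k over k < q)
and let E := 1 - 2xC.  The full Catalan series satisfies
1 - 2xC(x) = sqrt(1 - 4x), so E ^ 2 agrees with 1 - 4x below degree q + 1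
([sqr_catalan_sqrt]).  On the other side, put h := (q + 1) / 2, let Q be the
quotient of the statement, so that (1 - 4x)^h = 1 - 2xQ, and let
A := 1 - 2x(Q - x^(q - 1)) = (1 - 4x)^h + 2x^q.  Modulo p the Frobenius map
gives
<<
  (1 - 4x)^(2h) = (1 - 4x)(1 - 4x)^q = (1 - 4x)(1 - 4x^q),
>>
so A ^ 2 = 1 - 4x - 4x^q + 4x^q = 1 - 4x below degree q + 1: the
correction term x^(q - 1) is exactly what kills the coefficient -4 of x^q.
Thus A and E are two square roots of 1 - 4x modulo x^(q + 1), both with
constant term 1.  As A + E has the unit 2 as constant term, they coincide modulo
x^(q + 1) ([dvdp_Xn_sub_of_sqr]), that is, Q - x^(q - 1) and C coincide modulo
x^q; both have degree less than q.

The fact about E ^ 2 is obtained over the integers, without the Catalan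
convolution: the recurrence of the Catalan numbers is the differential equation
(1 - 4x)E' + 2E = 0 truncated at degree n ([deriv_catalan_sqrt]), and it makes
E ^ 2 and 1 - 4x solutions of the same first-order equation, with the same
initial value.  Uniqueness of the solution divides by positive integers, hence
has to take place in characteristic 0, before reduction modulo p. *)

Lemma catalanS (n : nat) :
  (n.+2 * catalan n.+1 = 2 * n.*2.+1 * catalan n)%N.
Proof.
(* Two steps around the odd row 2n + 1 of Pascal's triangle. *)
have mid : (n.+1 * 'C(n.*2.+1, n) = n.*2.+1 * 'C(2 * n, n))%N.
  rewrite mul2n; have := mul_bin_down n.*2.+1 n.
  by rewrite /= => ->; congr (_ * _)%N; lia.
have top : (n.+1 * 'C(2 * n.+1, n.+1) = n.+1.*2 * 'C(n.*2.+1, n))%N.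
  by rewrite mul2n -mul_bin_diag.
apply/eqP; rewrite mul_catalan -(eqn_pmul2l (ltn0Sn n)) top.
move: mid; rewrite -mul_catalan -muln2 => mid.
apply/eqP; nia.
Qed.

Definition catalan_poly (R : nzRingType) (n : nat) : {poly R} :=
  \sum_(0 <= k < n) (catalan k)%:R *: 'X^k.

(** A truncation of the power series of sqrt(1 - 4x). *)
Definition catalan_sqrt (R : nzRingType) (n : nat) : {poly R} :=
  1 - 2 * 'X * catalan_poly R n.

Lemma deriv_natr_mulXn (R : nzRingType) (k n : nat) :
  (k%:R * 'X^n : {poly R})^`() = k%:R * (n%:R * 'X^(n.-1)).
Proof.
by rewrite -polyC_natr mul_polyC derivZ derivXn -mul_polyC mulr_natl.
Qed.

(** The equation (1 - 4x)y' = -2y of y = sqrt(1 - 4x).  Passing from n to n + 1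
subtracts 2 C_n x^(n+1), which trades the defect at x^n for one at x^(n+1);
the new defect is the expected one by [catalanS]. *)
Lemma deriv_catalan_sqrt (R : comNzRingType) (n : nat) :
  (1 - 4 * 'X) * (catalan_sqrt R n)^`() + 2 * catalan_sqrt R n
  = (2 * n.+1 * catalan n)%:R * 'X^n.
Proof.
elim: n => [|n IHn].
  rewrite /catalan_sqrt /catalan_poly big_geq // mulr0 subr0 derivC.
  by rewrite (_ : catalan 0 = 1)%N // mulr0 add0r.
have -> : catalan_sqrt R n.+1
    = catalan_sqrt R n - (2 * catalan n)%:R * 'X^(n.+1).
  rewrite /catalan_sqrt /catalan_poly big_nat_recr //= -mul_polyC.
  rewrite polyC_natr natrM exprSr; ring.
have rec : n.+2%:R * (catalan n.+1)%:R = 2 * n.*2.+1%:R * (catalan n)%:R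
    :> {poly R} by rewrite -!natrM catalanS.
rewrite derivB deriv_natr_mulXn exprSr /=.
transitivity ((1 - 4 * 'X) * (catalan_sqrt R n)^`() + 2 * catalan_sqrt R n
    - (2 * catalan n)%:R * ((1 - 4 * 'X) * n.+1%:R + 2 * 'X) * 'X^n).
  by ring.
rewrite IHn !natrM -[2 * n.+2%:R * _]mulrA rec -muln2.
rewrite -[(n * 2).+1%:R]natr1 natrM.
by ring.
Qed.

(** The difference H of both sides satisfies (1 - 4x)H' + 4H = 0 below degree n
with H(0) = 0.  Its coefficients then obey (i + 1) H_(i+1) = 4(i - 1) H_i, and
they vanish one after the other because the integers i + 1 are not zero
divisors. *)
Lemma sqr_catalan_sqrt (R : numDomainType) (n : nat) :
  exists K : {poly R}, catalan_sqrt R n ^+ 2 = 1 - 4 * 'X + 'X^(n.+1) * K.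
Proof.
set E := catalan_sqrt R n.
pose H := E ^+ 2 - (1 - 4 * 'X).
pose c : {poly R} := (2 * n.+1 * catalan n)%:R.
have ode : (1 - 4 * 'X) * H^`() + 4 * H = 2 * c * E * 'X^n.
  have dL : (1 - 4 * 'X)^`() = - 4 :> {poly R}.
    rewrite derivB derivC sub0r -['X]expr1 deriv_natr_mulXn expr0.
    by rewrite !mulr1.
  have := deriv_catalan_sqrt R n; rewrite -/E -/c /H => eqE.
  rewrite derivB expr2 derivM dL.
  transitivity (2 * E * ((1 - 4 * 'X) * E^`() + 2 * E)); first by ring.
  rewrite eqE; ring.
have H0 i : (i <= n)%N -> H`_i = 0.
  elim: i => [_|i IHi lt_in].
    by rewrite -horner_coef0 /H /E /catalan_sqrt -!polyC_natr !hornerE; ring.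
  have Hi := IHi (ltnW lt_in).
  have := congr1 (fun p : {poly R} => p`_i) ode.
  rewrite coefMXn lt_in mulrBl mul1r -!polyC_natr coefD coefB -!mulrA.
  rewrite !coefCM coefXM.
  rewrite !coef_deriv Hi.
  have -> : (if i == 0%N then 0 else H`_i.-1.+1 *+ i.-1.+1) = 0.
    by case: i Hi {IHi lt_in} => //= i ->; rewrite mul0rn.
  rewrite !mulr0 subr0 addr0 => /eqP.
  by rewrite mulrn_eq0 => /eqP.
exists (drop_poly n.+1 H).
have take0 : take_poly n.+1 H = 0.
  apply/polyP => i; rewrite coef_take_poly coef0.
  by case: ltnP => // le_in; exact: H0.
have := poly_take_drop n.+1 H; rewrite take0 add0r mulrC => ->.
by rewrite /H; ring.
Qed.

(** Frobenius fixes 4 because 4 is a sum of ones. *)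
Lemma expr_one_sub_4mul_pchar (R : comNzRingType) (x : R) (q : nat) :
  [char R].-nat q -> odd q -> (1 - 4 * x) ^+ q = 1 - 4 * x ^+ q.
Proof.
move=> pq q_odd; rewrite exprDn_pchar // expr1n exprNn -signr_odd q_odd expr1.
rewrite mulN1r exprMn (_ : 4 = (1 + 1) + (1 + 1)); last by ring.
by rewrite !exprDn_pchar // !expr1n.
Qed.

(** The division by 2x in the theorem is exact, and the quotient has degree
less than n.  Induction avoids the binomial expansion: multiplying 1 - 2xQ by
1 - 4x gives an expression of the same shape. *)
Lemma one_sub_4X_exp (R : comNzRingType) (n : nat) :
  exists2 Q : {poly R}, (size Q <= n)%N & (1 - 4 * 'X) ^+ n = 1 - 2 * 'X * Q.
Proof.
elim: n => [|n [Q szQ IHn]].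
  by exists 0; rewrite ?size_poly0 // mulr0 subr0.
exists (2 + Q - 4 * 'X * Q); last by rewrite exprS IHn; ring.
apply/leq_sizeP => i lt_ni.
rewrite -!polyC_natr -!mulrA coefB coefD coefC coefCM coefXM.
rewrite -(prednK (leq_ltn_trans (leq0n n) lt_ni)) /=.
rewrite !(leq_sizeP _ _ szQ) ?mulr0 ?addr0 ?subr0 //; lia.
Qed.

(** Uniqueness of square roots of power series: a factor A + B with nonzero
constant term is invertible modulo every power of x. *)
Lemma dvdp_Xn_sub_of_sqr (F : fieldType) (n : nat) (A B : {poly F}) :
  (A + B).[0] != 0 -> 'X^n %| A ^+ 2 - B ^+ 2 -> 'X^n %| A - B.
Proof.
move=> nz; rewrite subr_sqr Gauss_dvdpl // coprimep_sym.
by apply: coprimep_expr; rewrite coprimepX.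
Qed.

Theorem theorem4 (p s q : nat) (p_prime : prime p) (p_odd : odd p)
    (s_gt0 : (0 < s)%N) (q_def : q = (p ^ s)%N) :
  exists Q : {poly int},
    (2 *: 'X) * Q = 1 - (1 - 4 *: 'X) ^+ ((q + 1) %/ 2)%N /\
    congr_polyz p (\sum_(0 <= k < q) (catalan k)%:Z *: 'X^k) (Q - 'X^(q - 1)).
Proof.
have scaleX k : k%:R *: 'X = k%:R * 'X :> {poly int}.
  by rewrite -mul_polyC polyC_natr.
have q_odd : odd q by rewrite q_def oddX p_odd orbT.
have q_gt1 : (1 < q)%N.
  by rewrite q_def -(exp1n s) ltn_exp2r // prime_gt1.
rewrite !scaleX; set h := ((q + 1) %/ 2)%N.
have hq : (h + h = q.+1)%N by rewrite /h; lia.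
have [Q szQ DQ] := one_sub_4X_exp int h.
exists Q; split; first by rewrite DQ opprB addrC subrK.
have -> : \sum_(0 <= k < q) (catalan k)%:Z *: 'X^k = catalan_poly int q.
  by apply: eq_bigr => k _; rewrite -natz.
have pF := pchar_Fp p_prime.
have two_neq0 : (2 : 'F_p) != 0.
  rewrite -(dvdn_pcharf pF) gtnNdvd //.
  by rewrite ltn_neqAle prime_gt1 // andbT; case: eqP p_odd => // <-.
pose m : {rmorphism {poly int} -> {poly 'F_p}} := map_poly intr.
have mX : m 'X = 'X by exact: map_polyX.
have mE P : m (1 - 2 * 'X * P) = 1 - 2 * 'X * m P.
  by rewrite rmorphB rmorph1 !rmorphM rmorph_nat mX.
pose R := Q - 'X^(q - 1).
have Xq : 'X^q = 'X * 'X^(q - 1) :> {poly 'F_p}.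
  by rewrite -exprS subn1 prednK // ltnW.
have dvd_sqr :
    'X^(q.+1) %| m (1 - 2 * 'X * R) ^+ 2 - m (catalan_sqrt int q) ^+ 2.
  have Dq : (1 - 2 * 'X * m Q) ^+ 2 = (1 - 4 * 'X) * (1 - 4 * 'X^q).
    rewrite -mE -DQ rmorphXn rmorphB rmorph1 rmorphM rmorph_nat mX.
    rewrite expr2 -exprD hq exprS expr_one_sub_4mul_pchar //.
    rewrite (eq_pnat _ (pchar_poly _)) q_def pnatX.
    by rewrite pnatE // pF.
  have [K EK] := sqr_catalan_sqrt int q.
  rewrite -[m (catalan_sqrt _ _) ^+ 2]rmorphXn EK mE /R rmorphB rmorphXn mX.
  rewrite rmorphD rmorphB rmorph1 !rmorphM rmorph_nat rmorphXn mX.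
  have -> : (1 - 2 * 'X * (m Q - 'X^(q - 1))) ^+ 2
      = (1 - 2 * 'X * m Q) ^+ 2 + 4 * 'X^q * (1 - 2 * 'X * m Q) + 4 * 'X^q ^+ 2.
    by rewrite Xq; ring.
  rewrite Dq exprS.
  (* The terms of degree q cancel; of the rest, only x^(2q) needs q >= 1 to be
     a multiple of x^(q+1). *)
  apply/dvdpP; exists (16 - 8 * m Q + 4 * 'X^(q - 1) - m K).
  by rewrite [_ ^+ 2]expr2 {3}Xq; ring.
have lt_q i : (i < q)%N -> (m R)`_i = (m (catalan_poly int q))`_i.
  move=> lt_iq; apply/eqP; rewrite -subr_eq0 -coefB.
  have := dvdp_Xn_sub_of_sqr _ dvd_sqr.
  rewrite /catalan_sqrt !mE.
  case/(_ _)/dvdpP => [|T eqT].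
    by rewrite -!polyC_natr !hornerE /= oppr0 !addr0.
  have := congr1 (fun P : {poly 'F_p} => P`_i.+1) eqT.
  rewrite coefMXn ltnS lt_iq.
  (* A - B is only known through its product with -2x, whence the shifted
     index and the use of 2 != 0. *)
  set A := m R; set B := m _.
  have -> : 1 - 2 * 'X * A - (1 - 2 * 'X * B) = (- 2)%:P * ('X * (A - B)).
    by rewrite polyCN polyC_natr; ring.
  rewrite coefCM coefXM /= => /eqP.
  by rewrite mulf_eq0 oppr_eq0 (negPf two_neq0).
have ge_q i : (q <= i)%N -> R`_i = (catalan_poly int q)`_i.
  move=> le_qi; rewrite /R coefB coefXn coef_sum big_nat big1 => [|k kq].
    rewrite (_ : (i == _) = false) ?subr0; last by apply/eqP; lia.
    by apply: nth_default; apply: leq_trans szQ _; lia.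
  rewrite coefZ coefXn (_ : (i == _) = false) ?mulr0 //; apply/eqP; lia.
move=> i; have [iq|qi] := ltnP i q; last by rewrite ge_q.
apply/eqP; rewrite eqz_mod_dvd (dvdz_pcharf pF) rmorphB subr_eq0.
by have := lt_q i iq; rewrite !coef_map => ->.
Qed.
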